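(* Let $A=\{\mathbf{a}_1,\dots,\mathbf{a}_n\}\subseteq\mathbb{R}^d$ with hidden partition $\mathcal{V}=\{V_1,\dots,V_K\}$, and weights $w_{ij}=w_{ji}\ge0$, satisfying the three standing assumptions (distinct centroids, weight condition, $n>K(K+1)$) below; let $\gamma_{\min},\gamma_{\max},\gamma_{\max2},r,r_2$ be as below. Let $p>2$, $\delta:=2/n^p$, and for $\epsilon\in(0,1)$ let $\mathcal{D}_{\epsilon,\delta}$ be a DJL distribution over $\mathbb{R}^{m\times d}$ with $m=O(p\epsilon^{-2}\log n)$, where the implicit absolute constant $c$ is the same one used in $\epsilon_{\min}:=\sqrt{c\,p\log(n)/d}$; assume $m<d$ (equivalently $\epsilon_{\min}<1$ and $\epsilon\in(\epsilon_{\min},1)$). Define $\epsilon_{\sup}:=\frac{r^2-1}{r^2+1}$ and $\epsilon_{\sup2}:=\frac{r_2^2-1}{r_2^2+1}$. Let $\Pi$ be drawn from $\mathcal{D}_{\epsilon,\delta}$, and for $\gamma\ge0$ let $\hat\phi_\gamma(\mathbf{a}_i):=\hat{\mathbf{x}}_i^*(\gamma)$, where $\{\hat{\mathbf{x}}_i^*(\gamma)\}$ is the optimal solution of the randomly projected convex clustering model with $\Pi$ and $\gamma$. Then: 1. If $r>\sqrt{\frac{1+\epsilon_{\min}}{1-\epsilon_{\min}}}$, then $\epsilon_{\min}<\epsilon_{\sup}$, and for any $\epsilon\in[\epsilon_{\min},\epsilon_{\sup})$ and any $\hat\gamma\in[\sqrt{1+\epsilon}\,\gamma_{\min},\sqrt{1-\epsilon}\,\gamma_{\max})$,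 with probability greater than $1-n^{-(p-2)}$ the map $\hat\phi_{\hat\gamma}$ perfectly recovers $\mathcal{V}$. 2. If $r_2>\sqrt{\frac{1+\epsilon_{\min}}{1-\epsilon_{\min}}}$, then $\epsilon_{\min}<\epsilon_{\sup2}$, and for any $\epsilon\in[\epsilon_{\min},\epsilon_{\sup2})$ and any $\hat\gamma\in[\sqrt{1+\epsilon}\,\gamma_{\min},\sqrt{1-\epsilon}\,\gamma_{\max2})$, with probability greater than $1-n^{-(p-2)}$ the map $\hat\phi_{\hat\gamma}$ recovers a non-trivial coarsening of $\mathcal{V}$.
   Context: $\|\cdot\|$ is the Euclidean norm. Notation: $I_\alpha:=\{i:\mathbf{a}_i\in V_\alpha\}$, $n_\alpha:=|I_\alpha|$, $\mathbf{a}^{(\alpha)}:=\frac1{n_\alpha}\sum_{i\in I_\alpha}\mathbf{a}_i$ ($1\le\alpha\le K$), $\mathbf{a}^{(0)}:=\frac1n\sum_i\mathbf{a}_i$; $w^{(\alpha,\beta)}:=\sum_{i\in I_\alpha}\sum_{j\in I_\beta}w_{ij}$; $\bar w^{(\beta)}:=\frac1{n_\beta}\sum_{l\ne\beta}w^{(\beta,l)}$; $w_i^{(\beta)}:=\sum_{j\in I_\beta}w_{ij}$; $\mu_{ij}^{(\alpha)}:=\sum_{\beta\ne\alpha}|w_i^{(\beta)}-w_j^{(\beta)}|$ for $i,j\in I_\alpha$. Standing assumptions: (i) $\mathbf{a}^{(0)},\mathbf{a}^{(1)},\dots,\mathbf{a}^{(K)}$ are pairwise distinct; (ii) $w_{ij}>0$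 and $n_\alpha w_{ij}>\mu_{ij}^{(\alpha)}$ for all distinct $i,j\in I_\alpha$, $1\le\alpha\le K$; (iii) $n>K(K+1)$. Quantities: $\gamma_{\min}:=\max_{\alpha}\max_{i\ne j\in I_\alpha}\frac{\|\mathbf{a}_i-\mathbf{a}_j\|}{n_\alpha w_{ij}-\mu_{ij}^{(\alpha)}}$, $\gamma_{\max}:=\min_{1\le\alpha<\beta\le K}\frac{\|\mathbf{a}^{(\alpha)}-\mathbf{a}^{(\beta)}\|}{\bar w^{(\alpha)}+\bar w^{(\beta)}}$, $\gamma_{\max2}:=\max_{1\le\alpha\le K}\frac{\|\mathbf{a}^{(0)}-\mathbf{a}^{(\alpha)}\|}{\bar w^{(\alpha)}}$, $r:=\gamma_{\max}/\gamma_{\min}$, $r_2:=\gamma_{\max2}/\gamma_{\min}$. Randomly projected convex clustering model with $\Pi\in\mathbb{R}^{m\times d}$ and $\gamma\ge0$: $\min_{\hat{\mathbf{x}}_1,\dots,\hat{\mathbf{x}}_n\in\mathbb{R}^m}\frac12\sum_{i=1}^n\|\hat{\mathbf{x}}_i-\Pi\mathbf{a}_i\|^2+\gamma\sum_{i<j}w_{ij}\|\hat{\mathbf{x}}_i-\hat{\mathbf{x}}_j\|$ (strongly convex, unique solution). A map $\psi$ on $A$ perfectly recovers $\mathcal{V}$ if $\psi(\mathbf{a}_i)=\psi(\mathbf{a}_j)$ iff $\mathbf{a}_i,\mathbf{a}_j$ lie in the same $V_\alpha$. A partition $\{W_1,\dots,W_L\}$ of $A$ is a coarsening of $\mathcal{V}$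 if there is a partition $\{\alpha_1,\dots,\alpha_L\}$ of $\{1,\dots,K\}$ with $W_l=\bigcup_{i\in\alpha_l}V_i$; it is non-trivial if $L>1$; $\psi$ recovers it if it is the partition of $A$ into level sets of $\psi$. A DJL distribution $\mathcal{D}_{\epsilon,\delta}$ is a distribution over $\Pi\in\mathbb{R}^{m\times d}$ with $\mathbb{P}[\,|\|\Pi z\|^2-1|>\epsilon\,]<\delta$ for every unit $z\in\mathbb{R}^d$. *)

(* Defs.v *)
From HB Require Import structures.
From mathcomp Require Import all_boot all_order all_algebra.
From mathcomp Require Import all_classical all_reals all_analysis.
Set Implicit Arguments. Unset Strict Implicit. Unset Printing Implicit Defensive.
Import Order.TTheory GRing.Theory Num.Theory.
Local Open Scope ring_scope.
Local Open Scope classical_set_scope.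

Section ConvexClustering.
Context {R : realType}.

Definition enorm (k : nat) (v : 'cV[R]_k) : R :=
  Num.sqrt (\sum_(i < k) v i ord0 ^+ 2).

(* maximum / minimum of a finite list of reals (0 on the empty list) *)
Definition max_of (s : seq R) : R := \big[Num.max/head 0 s]_(x <- s) x.
Definition min_of (s : seq R) : R := \big[Num.min/head 0 s]_(x <- s) x.

Variables (n d K : nat).
(* data points a_1..a_n (indexed by 'I_n), hidden partition given by the
   cluster label lab i (cluster alpha = V_alpha, alpha : 'I_K), weights w *)
Variables (a : 'I_n -> 'cV[R]_d) (lab : 'I_n -> 'I_K) (w : 'I_n -> 'I_n -> R).

Definition Iset (al : 'I_K) : {set 'I_n} := [set i | lab i == al].
Definition nsz (al : 'I_K) : R := (#|Iset al|)%:R.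
Definition centroid (al : 'I_K) : 'cV[R]_d :=
  (nsz al)^-1 *: \sum_(i in Iset al) a i.
Definition centroid0 : 'cV[R]_d := (n%:R)^-1 *: \sum_(i < n) a i.
Definition wblock (al be : 'I_K) : R :=
  \sum_(i in Iset al) \sum_(j in Iset be) w i j.
Definition wbar (be : 'I_K) : R :=
  (nsz be)^-1 * \sum_(l < K | l != be) wblock be l.
Definition wi (i : 'I_n) (be : 'I_K) : R := \sum_(j in Iset be) w i j.
Definition mu (al : 'I_K) (i j : 'I_n) : R :=
  \sum_(be < K | be != al) `|wi i be - wi j be|.

Definition gamma_min : R :=
  max_of [seq enorm (a q.1 - a q.2) /
              (nsz (lab q.1) * w q.1 q.2 - mu (lab q.1) q.1 q.2)
         | q <- enum [pred q : 'I_n * 'I_n | (lab q.1 == lab q.2) && (q.1 != q.2)]].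

Definition gamma_max : R :=
  min_of [seq enorm (centroid q.1 - centroid q.2) / (wbar q.1 + wbar q.2)
         | q <- enum [pred q : 'I_K * 'I_K | (q.1 < q.2)%N]].

Definition gamma_max2 : R :=
  max_of [seq enorm (centroid0 - centroid al) / wbar al | al <- enum 'I_K].

Definition cc_obj (m : nat) (Pi : 'M[R]_(m, d)) (g : R)
    (X : 'I_n -> 'cV[R]_m) : R :=
  2^-1 * \sum_(i < n) enorm (X i - Pi *m a i) ^+ 2
  + g * \sum_(i < n) \sum_(j < n | (i < j)%N) w i j * enorm (X i - X j).

(* X is an (the, by strong convexity) optimal solution *)
Definition cc_optimal (m : nat) (Pi : 'M[R]_(m, d)) (g : R)
    (X : 'I_n -> 'cV[R]_m) : Prop :=
  forall Y : 'I_n -> 'cV[R]_m, cc_obj Pi g X <= cc_obj Pi g Y.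

Definition perfectly_recovers (T : Type) (X : 'I_n -> T) : Prop :=
  forall i j : 'I_n, X i = X j <-> lab i = lab j.

(* the level-set partition of a_i |-> X i is a non-trivial coarsening:
   there is a partition of {1..K} into L > 1 nonempty blocks (the fibres
   of g) such that the level sets of X are the unions W_l of the V_alpha
   with g alpha = l *)
Definition recovers_nontrivial_coarsening (T : Type) (X : 'I_n -> T) : Prop :=
  exists (L : nat) (g : 'I_K -> 'I_L),
    (1 < L)%N /\ (forall l : 'I_L, exists al : 'I_K, g al = l) /\
    (forall i j : 'I_n, X i = X j <-> g (lab i) = g (lab j)).

End ConvexClustering.

(* Pi : T -> 'M_(m,d) is a random matrix on the probability space (T,P)
   whose law is a DJL distribution D_{eps,delta} *)
Definition DJL (R : realType) (m d : nat) (dT : measure_display)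
    (T : measurableType dT) (P : probability T R) (Pi : T -> 'M[R]_(m, d))
    (eps delta : R) : Prop :=
  forall z : 'cV[R]_d, enorm z = 1 ->
    let E := [set om | eps < `| enorm (Pi om *m z) ^+ 2 - 1 | ] in
    measurable E /\ (P E < delta%:E)%E.

(* Main.v *)
(** Clusters merge for every optimal [X] by comparing [X] with its cluster means
    [Y]: by convexity of the norm, the objective drops by at least half of
    [sum_i |X_i - Y_i|^2] as soon as [g (n_al w_ij - mu_ij)] dominates
    [|Pi a_i - Pi a_j|] inside each cluster.  Translating a set [A] of points
    shows that [|sum_(i in A) (Pi a_i - X_i)|] is at most [g] times the weight
    of the cut between [A] and its complement.  With [A] a cluster, merged
    clusters lie within [g * wbar] of their projected centroids, so those with
    well separated centroids stay apart; with [A] everything, a constant optimum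
    must be the projected global mean.  The projection distorts the relevant
    distances by at most [sqrt (1 +- eps)] with the announced probability, by a
    union bound over at most [n (n - 1) / 2 + K (K + 1) / 2 < n ^ 2 / 2]
    vectors. *)
Require Import Defs.
From HB Require Import structures.
From mathcomp Require Import all_boot all_order all_algebra.
From mathcomp Require Import all_classical all_reals all_analysis.
From mathcomp Require Import ring lra zify.
Import Order.TTheory GRing.Theory Num.Theory.
Local Open Scope ring_scope.
Local Open Scope classical_set_scope.

(** * Inner product, Euclidean norm and a subgradient of the norm *)

Section Euclid.
Context {R : realType} {k : nat}.
Implicit Types u v z : 'cV[R]_k.

Definition dot u v : R := \sum_(i < k) u i ord0 * v i ord0.

Lemma dotC u v : dot u v = dot v u.
Proof. by apply: eq_bigr => i _; rewrite mulrC. Qed.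

Lemma dotDr u v z : dot u (v + z) = dot u v + dot u z.
Proof. by rewrite -big_split; apply: eq_bigr => i _; rewrite !mxE mulrDr. Qed.

Lemma dotZr u v (t : R) : dot u (t *: v) = t * dot u v.
Proof. by rewrite big_distrr; apply: eq_bigr => i _; rewrite !mxE /=; ring. Qed.

Lemma dotNr u v : dot u (- v) = - dot u v.
Proof. by rewrite -scaleN1r dotZr mulN1r. Qed.

Lemma dotBr u v z : dot u (v - z) = dot u v - dot u z.
Proof. by rewrite dotDr dotNr. Qed.

Lemma dotDl u v z : dot (u + v) z = dot u z + dot v z.
Proof. by rewrite !(dotC _ z) dotDr. Qed.

Lemma dotZl u v (t : R) : dot (t *: u) v = t * dot u v.
Proof. by rewrite !(dotC _ v) dotZr. Qed.

Lemma dotBl u v z : dot (u - v) z = dot u z - dot v z.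
Proof. by rewrite !(dotC _ z) dotBr. Qed.

Lemma dotNl u v : dot (- u) v = - dot u v.
Proof. by rewrite !(dotC _ v) dotNr. Qed.

Lemma dot0r u : dot u 0 = 0.
Proof. by rewrite -(subrr u) dotBr subrr. Qed.

Lemma dot_sumr (I : finType) (Q : pred I) u (F : I -> 'cV[R]_k) :
  dot u (\sum_(i | Q i) F i) = \sum_(i | Q i) dot u (F i).
Proof. by apply: (big_morph (dot u)) => [x y|]; rewrite ?dotDr ?dot0r. Qed.

Lemma dot_suml (I : finType) (Q : pred I) u (F : I -> 'cV[R]_k) :
  dot (\sum_(i | Q i) F i) u = \sum_(i | Q i) dot (F i) u.
Proof. by rewrite dotC dot_sumr; apply: eq_bigr => i _; rewrite dotC. Qed.

Lemma enorm_ge0 u : 0 <= enorm u.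
Proof. exact: sqrtr_ge0. Qed.

Lemma sqr_enorm u : enorm u ^+ 2 = dot u u.
Proof.
by rewrite sqr_sqrtr ?sumr_ge0 // => i _; exact: sqr_ge0.
Qed.

Lemma enorm_eq0 u : (enorm u == 0) = (u == 0).
Proof.
apply/eqP/eqP => [u0|->]; last first.
  by rewrite /enorm big1 ?sqrtr0 // => i _; rewrite mxE expr0n.
have /eqP : \sum_(i < k) u i ord0 ^+ 2 = 0.
  by rewrite [LHS](_ : _ = dot u u) // -sqr_enorm u0 expr0n.
rewrite psumr_eq0 => [/allP h|i _]; last exact: sqr_ge0.
apply/matrixP => i j; rewrite ord1 mxE.
by have := h i (mem_index_enum i); rewrite sqrf_eq0 => /eqP.
Qed.

Lemma enorm0 : enorm (0 : 'cV[R]_k) = 0.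
Proof. by apply/eqP; rewrite enorm_eq0. Qed.

Lemma enormZ (t : R) u : enorm (t *: u) = `|t| * enorm u.
Proof.
apply/eqP; rewrite -(@eqrXn2 _ 2) ?mulr_ge0 ?enorm_ge0 ?normr_ge0 //.
by rewrite exprMn !sqr_enorm dotZl dotZr real_normK ?num_real // expr2 mulrA.
Qed.

Lemma enormN u : enorm (- u) = enorm u.
Proof. by rewrite -scaleN1r enormZ normrN1 mul1r. Qed.

Lemma enorm_sub u v : enorm (u - v) = enorm (v - u).
Proof. by rewrite -enormN opprB. Qed.

(** Cauchy-Schwarz: the squared norm of [enorm v *: u - enorm u *: v] is twice [enorm u * enorm v]
    times the gap between the two sides. *)
Lemma dot_le_enorm u v : dot u v <= enorm u * enorm v.
Proof.
have [->|v0] := eqVneq v 0; first by rewrite dot0r enorm0 mulr0.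
have [->|u0] := eqVneq u 0; first by rewrite dotC dot0r enorm0 mul0r.
have pu : 0 < enorm u by rewrite lt_def enorm_ge0 enorm_eq0 u0.
have pv : 0 < enorm v by rewrite lt_def enorm_ge0 enorm_eq0 v0.
have : 0 <= enorm (enorm v *: u - enorm u *: v) ^+ 2 by exact: sqr_ge0.
rewrite sqr_enorm dotBl !dotBr !dotZl !dotZr -!sqr_enorm (dotC v u) => h.
have : 0 <= (enorm u * enorm v) * (enorm u * enorm v - dot u v) by lra.
by rewrite pmulr_rge0 ?mulr_gt0 // subr_ge0.
Qed.

Lemma ler_enormD u v : enorm (u + v) <= enorm u + enorm v.
Proof.
rewrite -(@ler_pXn2r _ 2) ?nnegrE ?addr_ge0 ?enorm_ge0 //.
rewrite sqr_enorm dotDl !dotDr (dotC v u) sqrrD !sqr_enorm.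
by have := dot_le_enorm u v; lra.
Qed.

Lemma ler_enorm_sum (I : finType) (Q : pred I) (F : I -> 'cV[R]_k) :
  enorm (\sum_(i | Q i) F i) <= \sum_(i | Q i) enorm (F i).
Proof.
elim/big_ind2: _ => [|x1 x2 y1 y2 h1 h2|//]; first by rewrite enorm0.
exact: le_trans (ler_enormD _ _) (lerD h1 h2).
Qed.

(* A subgradient of the Euclidean norm; it is [0] at [z = 0]. *)
Definition unitv z : 'cV[R]_k := (enorm z)^-1 *: z.

Lemma dot_unitv z : dot (unitv z) z = enorm z.
Proof.
rewrite dotZl -sqr_enorm; have [->|z0] := eqVneq (enorm z) 0.
  by rewrite expr0n mulr0.
by field.
Qed.

Lemma enorm_unitv_le1 z : enorm (unitv z) <= 1.
Proof.
rewrite enormZ ger0_norm ?invr_ge0 ?enorm_ge0 //.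
by have [->|z0] := eqVneq (enorm z) 0; rewrite ?mulr0 // mulVf.
Qed.

Lemma unitvN z : unitv (- z) = - unitv z.
Proof. by rewrite /unitv enormN scalerN. Qed.

(** Cauchy-Schwarz for [unitv z] and [z + h], since [unitv z] has norm at most 1 and pairs with [z]
    to [enorm z]. *)
Lemma enorm_subgradient z h : dot (unitv z) h <= enorm (z + h) - enorm z.
Proof.
rewrite lerBrDl -{1}(dot_unitv z) -dotDr.
apply: le_trans (dot_le_enorm _ _) _.
by rewrite ler_piMl ?enorm_ge0 ?enorm_unitv_le1.
Qed.

End Euclid.

(** * Comparing an optimum with competitors *)

Section Deterministic.
Context {R : realType} {n d K m : nat}.
Context (a : 'I_n -> 'cV[R]_d) (lab : 'I_n -> 'I_K) (w : 'I_n -> 'I_n -> R).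
Context (Pi : 'M[R]_(m, d)) (g : R).
Implicit Types (X Y D : 'I_n -> 'cV[R]_m) (A : {set 'I_n}) (al be : 'I_K).

(** Full double sums can be regrouped by cluster or by cut, which sums over [i < j] cannot. *)
Lemma sum_offdiag_sym (F : 'I_n -> 'I_n -> R) :
  (forall i j, F i j = F j i) -> (forall i, F i i = 0) ->
  \sum_i \sum_j F i j = 2 * \sum_(i < n) \sum_(j < n | (i < j)%N) F i j.
Proof.
move=> Fsym F0.
have -> : \sum_i \sum_j F i j =
    \sum_(i < n) (\sum_(j < n | (i < j)%N) F i j
                  + \sum_(j < n | (j < i)%N) F i j).
  apply: eq_bigr => i _.
  rewrite (bigID (fun j : 'I_n => (i < j)%N)) /=; congr (_ + _).
  rewrite (bigD1 i) /= ?ltnn // F0 add0r; apply: eq_bigl => j.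
  by rewrite -leqNgt ltn_neqAle andbC.
rewrite big_split /= [X in _ + X](exchange_big_dep predT) //=.
rewrite mulrDl !mul1r; congr (_ + _).
by apply: eq_bigr => i _; apply: eq_bigr => j _; exact: Fsym.
Qed.

Lemma cc_obj_double X : (forall i j, w i j = w j i) ->
  2 * cc_obj a w Pi g X = \sum_i enorm (X i - Pi *m a i) ^+ 2
     + g * \sum_i \sum_j w i j * enorm (X i - X j).
Proof.
move=> wC; rewrite (@sum_offdiag_sym (fun i j => w i j * enorm (X i - X j))).
- by rewrite /cc_obj; field.
- by move=> i j; rewrite wC enorm_sub.
- by move=> i; rewrite subrr enorm0 mulr0.
Qed.

Lemma cc_optimal_double X Y : (forall i j, w i j = w j i) ->
  cc_optimal a w Pi g X ->
  0 <= \sum_i (enorm (Y i - Pi *m a i) ^+ 2 - enorm (X i - Pi *m a i) ^+ 2)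
     + g * \sum_i \sum_j w i j * (enorm (Y i - Y j) - enorm (X i - X j)).
Proof.
move=> wC /(_ Y); rewrite -(@ler_pM2l _ 2) // !cc_obj_double // -subr_ge0.
set u := _ - _; set v := _ + _; suff -> : v = u by [].
rewrite /v sumrB; under [X in _ + g * X]eq_bigr => i _.
  under eq_bigr => j _ do rewrite mulrBr.
  rewrite sumrB; over.
by rewrite sumrB /u; ring.
Qed.

(* Translating the points of [A] along the left-hand vector must not decrease
   the objective, and only the terms across the cut [A] / [~: A] resist. *)
Lemma cc_optimal_cut X A : (forall i j, w i j = w j i) ->
  (forall i j, 0 <= w i j) -> 0 <= g -> cc_optimal a w Pi g X ->
  enorm (\sum_(i in A) (Pi *m a i - X i)) <=
    g * \sum_(i in A) \sum_(j in ~: A) w i j.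
Proof.
move=> wC w0 g0 opt; rewrite leNgt; apply/negP.
set W := \sum_(i in A) \sum_(j in ~: A) _; set s := \sum_(i in A) _ => gW.
have W0 : 0 <= W by apply: sumr_ge0 => i _; apply: sumr_ge0.
have s0 : 0 < enorm s by apply: le_lt_trans gW; exact: mulr_ge0.
have A0 : (0 : R) < #|A|%:R.
  rewrite ltr0n card_gt0; apply/eqP => A0.
  by move: s0; rewrite /s A0 big_set0 enorm0 ltxx.
(* [t] minimises the quadratic upper bound [#|A| t^2 |s|^2 - 2 t |s|^2 + 2 g t |s| W] on the doubled
   change of objective. *)
pose t := (enorm s - g * W) / (#|A|%:R * enorm s).
have t0 : 0 < t by rewrite divr_gt0 ?mulr_gt0 // subr_gt0.
pose Y i : 'cV[R]_m := X i + if i \in A then t *: s else 0.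
have := @cc_optimal_double X Y wC opt; apply/negP; rewrite -ltNge.
have -> : \sum_i (enorm (Y i - Pi *m a i) ^+ 2 - enorm (X i - Pi *m a i) ^+ 2)
    = #|A|%:R * t ^+ 2 * enorm s ^+ 2 - 2 * t * enorm s ^+ 2.
  rewrite (bigID (mem A)) /= [X in _ + X]big1 ?addr0; last first.
    by move=> i /negbTE iA; rewrite /Y iA addr0 subrr.
  rewrite (eq_bigr (fun i => t ^+ 2 * enorm s ^+ 2
                             - 2 * t * dot s (Pi *m a i - X i))); last first.
    move=> i iA; rewrite /Y iA !sqr_enorm.
    rewrite !(dotDl, dotDr, dotNl, dotNr, dotZl, dotZr).
    by rewrite (dotC (X i) s) (dotC (Pi *m a i) s); ring.
  rewrite sumrB sumr_const -mulr_sumr -dot_sumr -/s -sqr_enorm.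
  by rewrite -[_ *+ #|A|]mulr_natl; ring.
(* Pairs on the same side of the cut move rigidly; each pair across it gains at most [t * enorm s]
   and is counted in both orders. *)
have hreg : \sum_i \sum_j w i j * (enorm (Y i - Y j) - enorm (X i - X j))
    <= 2 * (t * enorm s * W).
  have hW : \sum_i \sum_j w i j * ((i \in A) && (j \notin A))%:R = W.
    rewrite (bigID (mem A)) /= [X in _ + X]big1 ?addr0; last first.
      by move=> i /negbTE iA; apply: big1 => j _; rewrite iA mulr0.
    apply: eq_bigr => i iA; rewrite [RHS]big_mkcond; apply: eq_bigr => j _ /=.
    by rewrite iA inE; case: (j \in A); rewrite ?mulr0 ?mulr1.
  have -> : 2 * (t * enorm s * W) = \sum_i \sum_j
      (t * enorm s * (w i j * ((i \in A) && (j \notin A))%:R)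
     + t * enorm s * (w j i * ((j \in A) && (i \notin A))%:R)).
    under eq_bigr => i _ do rewrite big_split /= -!mulr_sumr.
    rewrite big_split /= -!mulr_sumr hW (exchange_big_dep predT) //= hW.
    by ring.
  apply: ler_sum => i _; apply: ler_sum => j _; rewrite (wC j i).
  have nt : enorm (t *: s) = t * enorm s by rewrite enormZ gtr0_norm.
  have ht : enorm (Y i - Y j) - enorm (X i - X j) <=
      enorm ((if i \in A then t *: s else 0) - (if j \in A then t *: s else 0)).
    rewrite lerBlDl; apply: le_trans (ler_enormD _ _).
    by rewrite /Y opprD addrACA.
  apply: le_trans (ler_wpM2l (w0 i j) ht) _.
  case: (i \in A) (j \in A) => [] [] /=;
    rewrite ?subrr ?subr0 ?sub0r ?enormN ?enorm0 ?nt; lra.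
have : g * \sum_i \sum_j w i j * (enorm (Y i - Y j) - enorm (X i - X j)) <=
    g * (2 * (t * enorm s * W)) by apply: ler_wpM2l.
(* With this [t] the quadratic term is half of the linear gain, so the doubled objective falls by at
   least [t |s| (|s| - g W) > 0]. *)
have tE : #|A|%:R * t * enorm s = enorm s - g * W.
  by rewrite /t; field; rewrite !lt0r_neq0.
have -> : #|A|%:R * t ^+ 2 * enorm s ^+ 2 =
    (#|A|%:R * t * enorm s) * (t * enorm s) by ring.
rewrite tE => hg.
have : 0 < t * enorm s * (enorm s - g * W).
  by apply: mulr_gt0; [exact: mulr_gt0 | rewrite subr_gt0].
nra.
Qed.

End Deterministic.

(** * Collapse of each cluster to a single point *)

Section Merge.
Context {R : realType} {n d K m : nat}.
Context (a : 'I_n -> 'cV[R]_d) (lab : 'I_n -> 'I_K) (w : 'I_n -> 'I_n -> R).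
Context (Pi : 'M[R]_(m, d)) (g : R).
Implicit Types (X Y D : 'I_n -> 'cV[R]_m) (A : {set 'I_n}) (al be : 'I_K).

Lemma nsz_gt0 i : 0 < nsz lab (lab i) :> R.
Proof. by rewrite ltr0n card_gt0; apply/set0Pn; exists i; rewrite inE. Qed.

Lemma sum_cluster_const i (t : R) :
  \sum_(j | lab j == lab i) t = nsz lab (lab i) * t.
Proof.
rewrite sumr_const mulr_natl; congr (_ *+ _).
by apply: eq_card => j; rewrite [in RHS]inE.
Qed.

Lemma sum_Iset_centroid_diff X al :
  \sum_(i in Iset lab al) (X i - centroid X lab (lab i)) = 0.
Proof.
have -> : \sum_(i in Iset lab al) (X i - centroid X lab (lab i)) =
    \sum_(i in Iset lab al) (X i - centroid X lab al).
  by apply: eq_bigr => i; rewrite inE => /eqP ->.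
rewrite sumrB sumr_const -scaler_nat scalerA.
(* Labels are not assumed surjective here: an empty cluster has an empty sum and size 0. *)
have [->|] := eqVneq (Iset lab al) finset.set0.
  by rewrite big_set0 /nsz cards0 mul0r scale0r subr0.
rewrite -card_gt0 -(ltr0n R) => /lt0r_neq0 N0.
by rewrite mulfV // scale1r subrr.
Qed.

Lemma sum_cluster_sym (F : 'I_n -> 'I_n -> R) (Q : rel 'I_K) :
  (forall al be, Q al be = Q be al) ->
  \sum_i \sum_(j | Q (lab j) (lab i)) F i j =
  \sum_i \sum_(j | Q (lab j) (lab i)) F j i.
Proof.
move=> Qsym; rewrite (exchange_big_dep predT) //=.
by apply: eq_bigr => i _; apply: eq_bigl => j; rewrite Qsym.
Qed.

(** Turns a linear term in [D] into pair differences, comparable with the within-cluster penalty. As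
    [D] sums to zero on each cluster, the mixed products cancel, and each [dot (D i) (c i)] survives
    [2 * nsz lab (lab i)] times. *)
Lemma sum_dot_cluster D (c : 'I_n -> 'cV[R]_m) :
  (forall al, \sum_(i in Iset lab al) D i = 0) ->
  \sum_i dot (D i) (c i) = \sum_i \sum_(j | lab j == lab i)
     (2 * nsz lab (lab i))^-1 * dot (D i - D j) (c i - c j).
Proof.
move=> D0.
pose G i j := (2 * nsz lab (lab i))^-1 * (dot (D i) (c i) - dot (D j) (c i)).
have -> : \sum_i \sum_(j | lab j == lab i)
     (2 * nsz lab (lab i))^-1 * dot (D i - D j) (c i - c j) =
     \sum_i \sum_(j | lab j == lab i) (G i j + G j i).
  apply: eq_bigr => i _; apply: eq_bigr => j /eqP ji.
  by rewrite /G ji dotBl !dotBr; ring.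
under [RHS]eq_bigr => i _ do rewrite big_split.
rewrite big_split /= -[X in _ + X](@sum_cluster_sym G eq_op); last exact: eq_sym.
rewrite -big_split; apply: eq_bigr => i _ /=.
have -> : \sum_(j | lab j == lab i) G i j = 2^-1 * dot (D i) (c i).
  rewrite -mulr_sumr sumrB sum_cluster_const -dot_suml.
  have -> : \sum_(j | lab j == lab i) D j = 0.
    by rewrite -[RHS](D0 (lab i)); apply: eq_bigl => j; rewrite inE.
  rewrite (dotC 0) dot0r subr0; have := nsz_gt0 i => /lt0r_neq0 N0.
  by field.
by field.
Qed.

(** The competitor [Y] has no within-cluster penalty. Linearising the cross-cluster penalty at [Y]
    gathers all linear terms in [D] into [c]; the freed within-cluster penalty absorbs them, and
    only the sum of the squared norms of [D] remains. *)
Lemma cc_optimal_merge X : (forall i j, w i j = w j i) ->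
  (forall i j, 0 <= w i j) -> 0 <= g ->
  (forall i j, lab i = lab j -> i != j ->
     enorm (Pi *m a i - Pi *m a j) + g * mu lab w (lab i) i j
       <= g * (nsz lab (lab i) * w i j)) ->
  cc_optimal a w Pi g X -> forall i j, lab i = lab j -> X i = X j.
Proof.
move=> wC w0 g0 gw opt.
pose y al : 'cV[R]_m := centroid X lab al.
pose Y i := y (lab i); pose D i := X i - Y i.
(* [h i] collects the cross-cluster subgradients at [Y], so [c] is a subgradient at [Y] of the
   doubled objective stripped of its within-cluster terms. *)
pose u al be := unitv (y al - y be).
pose h i := \sum_(be | be != lab i) wi lab w i be *: u (lab i) be.
pose c i := 2 *: (Y i - Pi *m a i) + (2 * g) *: h i.
have XE i : X i = Y i + D i by rewrite /D addrC subrK.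
suff sD : \sum_i enorm (D i) ^+ 2 <= 0.
  have D0 i : D i = 0.
    apply/eqP; rewrite -enorm_eq0 -sqrf_eq0.
    have : \sum_i enorm (D i) ^+ 2 == 0.
      by rewrite eq_le sD sumr_ge0 // => k _; exact: sqr_ge0.
    by rewrite psumr_eq0 => [/allP/(_ i (mem_index_enum _))|k _]; rewrite ?sqr_ge0.
  by move=> i j ij; rewrite !XE !D0 /Y ij.
have := @cc_optimal_double _ _ _ _ a w Pi g X Y wC opt.
have -> : \sum_i (enorm (Y i - Pi *m a i) ^+ 2 - enorm (X i - Pi *m a i) ^+ 2)
    = - \sum_i enorm (D i) ^+ 2 - \sum_i dot (D i) (2 *: (Y i - Pi *m a i)).
  rewrite -sumrN -sumrB; apply: eq_bigr => i _; rewrite XE !sqr_enorm.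
  move: (D i) (Y i) (Pi *m a i) => v z b.
  rewrite !(dotDl, dotDr, dotNl, dotNr, dotZl, dotZr).
  by rewrite (dotC v z) (dotC v b); ring.
(* [u] is antisymmetric and [w] symmetric, so both halves of [D i - D j] contribute equally;
   grouping [j] by cluster then produces [wi]. *)
have cross : \sum_i \sum_(j | lab j != lab i)
    w i j * dot (u (lab i) (lab j)) (D i - D j) = 2 * \sum_i dot (D i) (h i).
  pose G i j := w i j * dot (u (lab i) (lab j)) (D i).
  have -> : \sum_i \sum_(j | lab j != lab i)
      w i j * dot (u (lab i) (lab j)) (D i - D j) =
      \sum_i \sum_(j | lab j != lab i) (G i j + G j i).
    apply: eq_bigr => i _; apply: eq_bigr => j _; rewrite /G (wC j i).
    have -> : u (lab j) (lab i) = - u (lab i) (lab j).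
      by rewrite /u -unitvN opprB.
    by rewrite dotBr dotNl; ring.
  under eq_bigr => i _ do rewrite big_split.
  rewrite big_split /= -[X in _ + X](@sum_cluster_sym G (fun al be => al != be));
    last by move=> al be; rewrite eq_sym.
  rewrite -big_split mulr_sumr; apply: eq_bigr => i _ /=.
  suff -> : \sum_(j | lab j != lab i) G i j = dot (D i) (h i) by ring.
  rewrite (partition_big lab (fun be => be != lab i)) //= dot_sumr.
  apply: eq_bigr => be bei; rewrite dotZr dotC /wi mulr_suml.
  apply: congr_big => // [j|j /andP[_ /eqP jbe]]; last by rewrite /G jbe.
  by rewrite inE; have [->|_] := eqVneq (lab j) be; rewrite ?bei ?andbF.
(* Inside a cluster [Y i = Y j], so the whole term [enorm (D i - D j)] is gained; across clusters
   the subgradient inequality is applied at [Y i - Y j]. *)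
have reg : \sum_i \sum_j w i j * (enorm (Y i - Y j) - enorm (X i - X j)) <=
    - (\sum_i \sum_(j | lab j == lab i) w i j * enorm (D i - D j))
    - 2 * \sum_i dot (D i) (h i).
  rewrite -cross -!sumrN -big_split /=; apply: ler_sum => i _.
  rewrite (bigID (fun j => lab j == lab i)) /= -!sumrN; apply: lerD.
    apply: ler_sum => j /eqP ji; rewrite !XE /Y ji subrr enorm0 sub0r mulrN.
    by rewrite opprD addrACA subrr add0r.
  apply: ler_sum => j ji; rewrite -mulrN; apply: ler_wpM2l => //.
  rewrite !XE opprD addrACA -opprB lerN2.
  exact: enorm_subgradient.
have wit : - \sum_i dot (D i) (c i) <=
    g * \sum_i \sum_(j | lab j == lab i) w i j * enorm (D i - D j).
  rewrite (sum_dot_cluster D c); last by move=> al; exact: sum_Iset_centroid_diff.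
  rewrite -sumrN mulr_sumr; apply: ler_sum => i _.
  rewrite -sumrN mulr_sumr; apply: ler_sum => j /eqP ji.
  have [->|ij] := eqVneq i j.
    by rewrite !subrr dot0r enorm0 !mulr0 oppr0.
  have N0 := nsz_gt0 i.
  (* The common mean cancels in [c i - c j]. What remains is the projected difference and a
     combination of vectors of norm at most 1 whose coefficients add up to [mu] in absolute
     value. *)
  have cb : enorm (c i - c j) <= 2 * g * (nsz lab (lab i) * w i j).
    have -> : c i - c j = (- 2) *: (Pi *m a i - Pi *m a j) + (2 * g) *:
        \sum_(be | be != lab i) (wi lab w i be - wi lab w j be) *: u (lab i) be.
      under eq_bigr => be _ do rewrite scalerBl.
      rewrite sumrB /c /h /Y ji.
      set hi := \sum_(be | _) wi lab w i be *: _.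
      set hj := \sum_(be | _) _; move: (y _) hi hj => z hi hj.
      by apply/matrixP => p q; rewrite !mxE; ring.
    apply: le_trans (ler_enormD _ _) _; rewrite !enormZ normrN.
    rewrite (ger0_norm (_ : 0 <= 2)) // ger0_norm ?mulr_ge0 //.
    have hm : enorm (\sum_(be | be != lab i)
        (wi lab w i be - wi lab w j be) *: u (lab i) be) <= mu lab w (lab i) i j.
      apply: le_trans (ler_enorm_sum _ _ _) _; apply: ler_sum => be _.
      by rewrite enormZ ler_piMr ?enorm_unitv_le1.
    have := gw i j (esym ji) ij.
    have := ler_wpM2l g0 hm; lra.
  have hd : dot (D j - D i) (c i - c j) <=
     enorm (D i - D j) * (2 * g * (nsz lab (lab i) * w i j)).
    apply: le_trans (dot_le_enorm _ _) _; rewrite enorm_sub.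
    by apply: ler_wpM2l => //; exact: enorm_ge0.
  rewrite -mulrN -dotNl opprB ler_pdivrMl ?mulr_gt0 //.
  by apply: le_trans hd _; lra.
have cE : \sum_i dot (D i) (c i) = \sum_i dot (D i) (2 *: (Y i - Pi *m a i))
    + 2 * g * \sum_i dot (D i) (h i).
  rewrite mulr_sumr -big_split; apply: eq_bigr => i _ /=.
  by rewrite dotDr (dotZr _ _ (2 * g)).
have := ler_wpM2l g0 reg; lra.
Qed.

End Merge.

(** * Location of the merged clusters, and recovery criteria *)

Section Recovery.
Context {R : realType} {n d K m : nat}.
Context (a : 'I_n -> 'cV[R]_d) (lab : 'I_n -> 'I_K) (w : 'I_n -> 'I_n -> R).
Context (Pi : 'M[R]_(m, d)) (g : R).
Implicit Types (X : 'I_n -> 'cV[R]_m) (al be : 'I_K).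

Lemma wbar_ge0 al : (forall i j, 0 <= w i j) -> 0 <= wbar lab w al.
Proof.
move=> w0; apply: mulr_ge0; first by rewrite invr_ge0 ler0n.
by do 3![apply: sumr_ge0 => ? _].
Qed.

(** The cut bound for a cluster on which [X] is constant: both sides carry the factor
    [nsz lab (lab i)], which cancels. *)
Lemma cc_optimal_centroid X i : (forall i j, w i j = w j i) ->
  (forall i j, 0 <= w i j) -> 0 <= g -> cc_optimal a w Pi g X ->
  (forall j, lab j = lab i -> X j = X i) ->
  enorm (Pi *m centroid a lab (lab i) - X i) <= g * wbar lab w (lab i).
Proof.
move=> wC w0 g0 opt Xi.
have := @cc_optimal_cut _ _ _ _ a w Pi g X (Iset lab (lab i)) wC w0 g0 opt.
have N0 := @nsz_gt0 R _ _ lab i.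
have -> : \sum_(j in Iset lab (lab i)) (Pi *m a j - X j) =
    nsz lab (lab i) *: (Pi *m centroid a lab (lab i) - X i).
  rewrite sumrB -mulmx_sumr (eq_bigr (fun=> X i) (F1 := X)); last first.
    by move=> j; rewrite inE => /eqP; exact: Xi.
  rewrite sumr_const -scaler_nat scalerBr -scalemxAr scalerA mulfV ?scale1r //.
  exact: lt0r_neq0.
have -> : \sum_(j in Iset lab (lab i)) \sum_(l in ~: Iset lab (lab i)) w j l =
    nsz lab (lab i) * wbar lab w (lab i).
  rewrite /wbar mulrA mulfV ?lt0r_neq0 // mul1r /wblock [RHS]exchange_big /=.
  apply: eq_bigr => j _; rewrite (partition_big lab (fun be => be != lab i)) /=.
    apply: eq_bigr => be bei; apply: eq_bigl => l.
    by rewrite !inE; have [->|_] := eqVneq (lab l) be; rewrite ?bei ?andbF.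
  by move=> l; rewrite !inE.
by rewrite enormZ gtr0_norm // mulrCA ler_pM2l.
Qed.

(** No weight leaves the full index set, so the cut bound forces the residuals to sum to zero. *)
Lemma cc_optimal_const X x : (forall i j, w i j = w j i) ->
  (forall i j, 0 <= w i j) -> 0 <= g -> (0 < n)%N -> cc_optimal a w Pi g X ->
  (forall i, X i = x) -> x = Pi *m centroid0 a.
Proof.
move=> wC w0 g0 n0 opt Xx.
have := @cc_optimal_cut _ _ _ _ a w Pi g X [set: 'I_n]%SET wC w0 g0 opt.
rewrite [X in g * X]big1 ?mulr0; last first.
  by move=> i _; rewrite big1 // => j; rewrite !inE.
move=> s0; have /eqP : enorm (\sum_(i in [set: 'I_n]%SET) (Pi *m a i - X i)) == 0.
  by rewrite eq_le s0 enorm_ge0.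
rewrite (eq_bigl xpredT) => [|i]; last by rewrite inE.
move/eqP; rewrite enorm_eq0 sumrB subr_eq0 => /eqP e.
rewrite /centroid0 -scalemxAr mulmx_sumr e (eq_bigr (fun=> x)) //.
rewrite sumr_const card_ord -[x *+ n]scaler_nat scalerA mulVf ?scale1r //.
by rewrite pnatr_eq0 -lt0n.
Qed.

(** A value shared by two clusters would, by the triangle inequality through it, bring their
    projected centroids too close. *)
Lemma perfect_recovery X : (forall i j, w i j = w j i) ->
  (forall i j, 0 <= w i j) -> 0 <= g -> cc_optimal a w Pi g X ->
  (forall i j, lab i = lab j -> X i = X j) ->
  (forall al be, al != be -> g * (wbar lab w al + wbar lab w be) <
     enorm (Pi *m (centroid a lab al - centroid a lab be))) ->
  perfectly_recovers lab X.
Proof.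
move=> wC w0 g0 opt Xlab sep i j; split; last exact: Xlab.
move=> Xij; apply: contrapT => /eqP/sep; apply/negP; rewrite -leNgt.
have hi := cc_optimal_centroid X i wC w0 g0 opt (fun k => Xlab k i).
have hj := cc_optimal_centroid X j wC w0 g0 opt (fun k => Xlab k j).
rewrite mulrDr; apply: le_trans (lerD hi hj).
rewrite (enorm_sub _ (X j)) Xij; apply: le_trans (ler_enormD _ _).
by rewrite addrA subrK mulmxBr.
Qed.

(** Blocks are numbered by the position of their common value in the duplicate-free list [s] of
    values taken on clusters. *)
Lemma level_sets_coarsening (T : eqType) (X : 'I_n -> T) (i0 j0 : 'I_n) :
  (forall al, exists i, lab i = al) ->
  (forall i j, lab i = lab j -> X i = X j) -> X i0 != X j0 ->
  recovers_nontrivial_coarsening lab X.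
Proof.
move=> /choice[rep repE] Xlab X0.
pose f al := X (rep al); have fE i : f (lab i) = X i by apply: Xlab.
pose s := undup (codom f).
have fs al : (index (f al) s < size s)%N by rewrite index_mem mem_undup codom_f.
pose h al := Ordinal (fs al).
have hP al be : h al = h be <-> f al = f be.
  split=> [/(congr1 val)/= e|e]; last by apply: val_inj => /=; rewrite e.
  have F z : nth (f al) s (index (f z) s) = f z.
    by rewrite nth_index // mem_undup codom_f.
  by rewrite -(F al) e F.
exists (size s), h; split; last split.
(* With at most one value in [s], all positions would be 0, against [X i0 != X j0]. *)
- rewrite ltnNge; apply: contraNN X0 => s1.
  rewrite -!fE; apply/eqP/hP/val_inj => /=.
  have := fs (lab i0); have := fs (lab j0); lia.
- move=> l; have /codomP[al e] : nth (X i0) s l \in codom f.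
    by rewrite -mem_undup mem_nth.
  by exists al; apply: val_inj; rewrite /= -e index_uniq ?undup_uniq.
- by move=> i j; rewrite -!fE; split=> /hP.
Qed.

(** A constant optimum would be the projected global mean, which [sep] puts too far from the
    projected centroid of [al]. *)
Lemma nontrivial_coarsening X al : (forall i j, w i j = w j i) ->
  (forall i j, 0 <= w i j) -> 0 <= g -> cc_optimal a w Pi g X ->
  (forall al, exists i, lab i = al) ->
  (forall i j, lab i = lab j -> X i = X j) ->
  g * wbar lab w al < enorm (Pi *m (centroid0 a - centroid a lab al)) ->
  recovers_nontrivial_coarsening lab X.
Proof.
move=> wC w0 g0 opt surj Xlab sep; have [i li] := surj al.
have [j ij] : exists j, X i != X j.
  apply: contrapT => /forallNP Xc.
  have Xi j : X j = X i by apply/eqP/negPn/negP; rewrite eq_sym; exact: Xc.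
  have n0 : (0 < n)%N by apply: leq_ltn_trans (ltn_ord i).
  have XE := cc_optimal_const X _ wC w0 g0 n0 opt Xi.
  have := cc_optimal_centroid X i wC w0 g0 opt (fun k => Xlab k i).
  by rewrite XE li enorm_sub -mulmxBr leNgt sep.
exact: level_sets_coarsening surj Xlab ij.
Qed.

End Recovery.

(** * Extrema of finite lists *)

Section Extrema.
Context {R : realType}.
Implicit Types (s : seq R) (x : R).

Lemma le_max_of s x : x \in s -> x <= max_of s.
Proof. by move=> xs; rewrite /max_of; exact: le_bigmax_seq. Qed.

Lemma ge_min_of s x : x \in s -> min_of s <= x.
Proof. by move=> xs; rewrite /min_of; exact: ge_bigmin_seq. Qed.

(** The default [head 0 s] is itself an entry of a nonempty list, so the fold never leaves the
    list. *)
Lemma max_of_mem s : s != [::] -> max_of s \in s.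
Proof.
case: s => // x s _; rewrite /max_of /=.
have : forall t, \big[Num.max/x]_(y <- t) y \in x :: t.
  elim=> [|y t IH]; first by rewrite big_nil inE.
  rewrite big_cons; case: leP => _; last by rewrite !inE eqxx orbT.
  by move: IH; rewrite !inE => /orP[->|->]; rewrite ?orbT.
by move=> /(_ (x :: s)); rewrite !inE orbA orbb.
Qed.

Lemma max_of_ge0 s : (forall x, x \in s -> 0 <= x) -> 0 <= max_of s.
Proof.
have [->|s0] := eqVneq s [::]; first by rewrite /max_of big_nil.
by move=> h; apply/h/max_of_mem.
Qed.

End Extrema.

(** Used to count the vectors of the union bound: there are [j] pairs with larger entry [j]. *)
Lemma card_ltn_pairs k : #|[pred q : 'I_k * 'I_k | (q.1 < q.2)%N]| = 'C(k, 2).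
Proof.
rewrite -sum1_card (eq_bigl (fun q : 'I_k * 'I_k => (q.1 < q.2)%N)) //.
rewrite -(pair_big_dep xpredT (fun i j : 'I_k => (i < j)%N) (fun _ _ => 1%N)) /=.
rewrite (exchange_big_dep xpredT) //= -bin2_sum big_mkord.
apply: eq_bigr => j _; rewrite sum1_card -[RHS](card_ord j).
pose f := widen_ord (ltnW (ltn_ord j)).
have f_inj : injective f by move=> x y /(congr1 val)/= /val_inj.
rewrite -(fintype.card_image f_inj); apply: eq_card => i.
apply/idP/fintype.imageP => [ij|[l _ ->]]; last exact: (ltn_ord l).
by exists (Ordinal ij) => //; apply: val_inj.
Qed.

Lemma bin2_double k : (2 * 'C(k, 2) = k * k.-1)%N.
Proof. by rewrite -mul_bin_diag bin1. Qed.

(** * Union bound and distortion of distances *)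

Section RandomProjection.
Context {R : realType} {m d : nat} {dT : measure_display}.
Context {T : measurableType dT} (P : probability T R) (Pi : T -> 'M[R]_(m, d)).
Context (eps delta : R).

(** Induction on the complementary event: each nonzero vector, once normalised, adds one bad event
    of probability below [delta]. *)
Lemma DJL_union (s : seq 'cV[R]_d) : DJL P Pi eps delta -> 0 <= eps -> 0 <= delta ->
  exists E : set T, [/\ measurable E,
    forall om z, E om -> z \in s ->
      `|enorm (Pi om *m z) ^+ 2 - enorm z ^+ 2| <= eps * enorm z ^+ 2 &
    ((1 - (size s)%:R * delta)%:E <= P E)%E].
Proof.
move=> djl e0 d0.
suff [B [mB hB PB]] : exists B : set T, [/\ measurable B,
    forall om z, ~ B om -> z \in s ->
      `|enorm (Pi om *m z) ^+ 2 - enorm z ^+ 2| <= eps * enorm z ^+ 2 &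
    (P B <= ((size s)%:R * delta)%:E)%E].
  exists (~` B); split=> //; first exact: measurableC.
  by rewrite probability_setC // EFinB leeB.
elim: s => [|z s [B [mB hB PB]]].
  by exists set0; split=> //; rewrite measure0 mul0r.
(* The zero vector cannot be normalised, but it is never distorted and adds no bad event. *)
have [->|z0] := eqVneq z 0.
  exists B; split=> //.
    move=> om z' nB; rewrite inE => /predU1P[->|]; last exact: hB.
    by rewrite mulmx0 !enorm0 expr0n subrr normr0 mulr0.
  by apply: le_trans PB _; rewrite lee_fin ler_wpM2r // ler_nat.
have pz : 0 < enorm z by rewrite lt_def enorm_ge0 enorm_eq0 z0.
have uz : enorm ((enorm z)^-1 *: z) = 1.
  by rewrite enormZ ger0_norm ?invr_ge0 ?enorm_ge0 // mulVf ?lt0r_neq0.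
have [mC PC] := djl _ uz; set C := [set om | _] in mC PC.
exists (B `|` C); split; first exact: measurableU.
- move=> om z' nBC; rewrite inE => /predU1P[->|]; last first.
    by apply: hB => hb; apply: nBC; left.
  have : ~ C om by move=> hc; apply: nBC; right.
  rewrite /C /= => /negP; rewrite -leNgt -scalemxAr enormZ.
  rewrite (ger0_norm (_ : 0 <= (enorm z)^-1)) ?invr_ge0 ?enorm_ge0 // => h.
  have -> : enorm (Pi om *m z) ^+ 2 - enorm z ^+ 2 =
    (((enorm z)^-1 * enorm (Pi om *m z)) ^+ 2 - 1) * enorm z ^+ 2.
    by field; rewrite lt0r_neq0.
  by rewrite normrM (ger0_norm (sqr_ge0 _)) ler_wpM2r ?sqr_ge0.
- apply: le_trans (measureU2 _ mB mC) _.
  rewrite /= mulrSr mulrDl mul1r EFinD leeD //; exact: ltW.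
Qed.

Lemma norm_distortion om (z : 'cV[R]_d) : 0 <= eps -> eps <= 1 ->
  `|enorm (Pi om *m z) ^+ 2 - enorm z ^+ 2| <= eps * enorm z ^+ 2 ->
  Num.sqrt (1 - eps) * enorm z <= enorm (Pi om *m z)
    <= Num.sqrt (1 + eps) * enorm z.
Proof.
move=> e0 e1; rewrite ler_norml => /andP[lo hi].
have z0 := enorm_ge0 z; have p0 := enorm_ge0 (Pi om *m z).
apply/andP; split; rewrite -(@ler_pXn2r _ 2) ?nnegrE ?mulr_ge0 ?sqrtr_ge0 //.
  by rewrite exprMn sqr_sqrtr; lra.
by rewrite exprMn (@sqr_sqrtr _ (1 + eps)); lra.
Qed.

Lemma DJL_geometry {n K : nat} (a : 'I_n -> 'cV[R]_d) (lab : 'I_n -> 'I_K) (p : R) :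
  DJL P Pi eps delta -> 0 <= eps -> eps <= 1 ->
  delta = 2 / (n%:R `^ p) -> (K * K.+1 < n)%N ->
  exists E : set T, [/\ measurable E,
    ((1 - n%:R `^ (- (p - 2)))%:E < P E)%E &
    forall om, E om -> [/\
      forall i j, enorm (Pi om *m a i - Pi om *m a j)
                    <= Num.sqrt (1 + eps) * enorm (a i - a j),
      forall al be, Num.sqrt (1 - eps) * enorm (centroid a lab al - centroid a lab be)
        <= enorm (Pi om *m (centroid a lab al - centroid a lab be)) &
      forall al, Num.sqrt (1 - eps) * enorm (centroid0 a - centroid a lab al)
        <= enorm (Pi om *m (centroid0 a - centroid a lab al))]].
Proof.
move=> djl e0 e1 dE Kn.
have n0 : (0 : R) < n%:R by rewrite ltr0n (leq_ltn_trans _ Kn).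
have np0 : 0 < n%:R `^ p :> R by exact: powR_gt0.
pose s1 := [seq a q.1 - a q.2 | q <- enum [pred q : 'I_n * 'I_n | (q.1 < q.2)%N]].
pose s2 := [seq centroid a lab q.1 - centroid a lab q.2
           | q <- enum [pred q : 'I_K * 'I_K | (q.1 < q.2)%N]].
pose s3 := [seq centroid0 a - centroid a lab al | al <- enum 'I_K].
have d0 : 0 <= delta by rewrite dE divr_ge0 // ltW.
have [E [mE hE PE]] := DJL_union (s1 ++ s2 ++ s3) djl e0 d0.
exists E; split=> //.
- apply: lt_le_trans PE; rewrite lte_fin ltrD2l ltrN2.
  (* The failure bound is rewritten as [n^2 / n^p], so it remains to show that twice the number of
     vectors is below [n^2]. *)
  rewrite opprB powRB; last by rewrite lt0r_neq0 ?implybT.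
  rewrite (powR_mulrn 2) ?ltW // dE mulrA ltr_pM2r ?invr_gt0 //.
  rewrite -[2]/(2%:R) -natrM -natrX ltr_nat !size_cat /s1 /s2 /s3 !size_map -enumT size_enum_ord -!cardE.
  rewrite !card_ltn_pairs.
  (* Twice the count is [n (n - 1) + K (K - 1) + 2 K], which is below [n^2] exactly when
     [K (K + 1) < n]. *)
  have := bin2_double n; have := bin2_double K; nia.
move=> om Eom; have hb z : z \in s1 ++ s2 ++ s3 -> _ :=
  fun h => norm_distortion om z e0 e1 (hE om z Eom h).
split.
- move=> i j; wlog ij : i j / (i < j)%N => [hw|].
    have [ij|ji|/val_inj ->] := ltngtP i j; first exact: hw.
      by rewrite (enorm_sub (a i)) (enorm_sub (Pi om *m a i)); exact: hw.
    by rewrite !subrr !enorm0 mulr0.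
  have /hb/andP[_] : a i - a j \in s1 ++ s2 ++ s3.
    rewrite mem_cat; apply/orP; left; apply/mapP; exists (i, j) => //.
    by rewrite mem_enum.
  by rewrite mulmxBr.
- move=> al be; wlog ab : al be / (al < be)%N => [hw|].
    have [ab|ba|/val_inj ->] := ltngtP al be; first exact: hw.
      by rewrite -[centroid _ _ al - _]opprB mulmxN !enormN; exact: hw.
    by rewrite !subrr mulmx0 !enorm0 mulr0.
  have /hb/andP[//] : centroid a lab al - centroid a lab be \in s1 ++ s2 ++ s3.
  rewrite !mem_cat; apply/orP; right; apply/orP; left.
  by apply/mapP; exists (al, be); rewrite ?mem_enum.
- move=> al.
  have /hb/andP[//] : centroid0 a - centroid a lab al \in s1 ++ s2 ++ s3.
  rewrite !mem_cat; apply/orP; right; apply/orP; right.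
  by apply/mapP; exists al; rewrite ?mem_enum.
Qed.

End RandomProjection.

(** Squared, the hypothesis reads [1 + e < r^2 (1 - e)], which is the conclusion cleared of its
    denominator. *)
Lemma sqrt_ratio_lt (R : realType) (e r : R) : 0 <= e -> e < 1 ->
  Num.sqrt ((1 + e) / (1 - e)) < r -> e < (r ^+ 2 - 1) / (r ^+ 2 + 1).
Proof.
move=> e0 e1 er; have e1' : 0 < 1 - e by lra.
have q0 : 0 <= (1 + e) / (1 - e) by apply: divr_ge0; lra.
have r0 : 0 <= r by apply: le_trans (ltW er); exact: sqrtr_ge0.
have : (1 + e) / (1 - e) < r ^+ 2.
  by rewrite -(sqr_sqrtr q0) ltr_pXn2r // nnegrE ?sqrtr_ge0.
by rewrite ltr_pdivrMr // ltr_pdivlMr; [lra|nra].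
Qed.

Lemma sqr_ratio_lt1 (R : realType) (r : R) : (r ^+ 2 - 1) / (r ^+ 2 + 1) < 1.
Proof. by have := sqr_ge0 r => h; rewrite ltr_pdivrMr; lra. Qed.

(** * From the thresholds on gamma to the merging and separation criteria *)

Section Gammas.
Context {R : realType} {n d K : nat}.
Context (a : 'I_n -> 'cV[R]_d) (lab : 'I_n -> 'I_K) (w : 'I_n -> 'I_n -> R).
Context (w_gap : forall i j : 'I_n, lab i = lab j -> i != j ->
  0 < w i j /\ mu lab w (lab i) i j < nsz lab (lab i) * w i j).

Lemma gamma_min_ub i j : lab i = lab j -> i != j ->
  enorm (a i - a j) <=
    gamma_min a lab w * (nsz lab (lab i) * w i j - mu lab w (lab i) i j).
Proof.
move=> lij ij; have [_ h] := w_gap i j lij ij.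
rewrite -ler_pdivrMr ?subr_gt0 //; apply: le_max_of; apply/mapP.
by exists (i, j) => //; rewrite mem_enum inE /= lij eqxx.
Qed.

Lemma gamma_min_ge0 : 0 <= gamma_min a lab w.
Proof.
apply: max_of_ge0 => x /mapP[[i j]]; rewrite mem_enum inE => /andP[/eqP lij ij] ->.
have [_ h] := w_gap i j lij ij.
by rewrite divr_ge0 ?enorm_ge0 // subr_ge0 ltW.
Qed.

(** Stretching distances by at most [t] scales the threshold [gamma_min] by [t]; below, [t] is
    [Num.sqrt (1 + eps)]. *)
Lemma cc_optimal_gamma_min {m : nat} (Pi : 'M[R]_(m, d)) (t g : R)
    (X : 'I_n -> 'cV[R]_m) :
  (forall i j, w i j = w j i) -> (forall i j, 0 <= w i j) -> 0 <= t ->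
  (forall i j, enorm (Pi *m a i - Pi *m a j) <= t * enorm (a i - a j)) ->
  t * gamma_min a lab w <= g -> cc_optimal a w Pi g X ->
  forall i j, lab i = lab j -> X i = X j.
Proof.
move=> wC w0 t0 hPi tg; apply: cc_optimal_merge => //.
  by apply: le_trans tg; rewrite mulr_ge0 // gamma_min_ge0.
move=> i j lij ij; have [_ h] := w_gap i j lij ij.
rewrite -lerBrDr -mulrBr; apply: le_trans (hPi i j) _.
apply: le_trans (ler_wpM2l t0 (gamma_min_ub i j lij ij)) _.
by rewrite mulrA ler_wpM2r // subr_ge0 ltW.
Qed.

(* If [wbar al + wbar be = 0], the quotient in [gamma_max] is [0], which the
   hypothesis [0 < gamma_max] excludes. *)
Lemma gamma_max_lb al be : (forall i j, 0 <= w i j) -> 0 < gamma_max a lab w ->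
  al != be -> 0 < wbar lab w al + wbar lab w be /\
  gamma_max a lab w * (wbar lab w al + wbar lab w be) <=
    enorm (centroid a lab al - centroid a lab be).
Proof.
move=> w0 gp ab; wlog : al be ab / (al < be)%N => [hw|lab'].
  move: (ab); rewrite -val_eqE neq_ltn => /orP[lt|lt]; first exact: hw.
  by rewrite addrC enorm_sub; apply: hw => //; rewrite eq_sym.
have h : gamma_max a lab w <= enorm (centroid a lab al - centroid a lab be)
    / (wbar lab w al + wbar lab w be).
  by apply: ge_min_of; apply/mapP; exists (al, be); rewrite ?mem_enum.
have W0 : 0 < wbar lab w al + wbar lab w be.
  rewrite lt_def addr_ge0 ?wbar_ge0 // andbT; apply: contraTneq h => ->.
  by rewrite invr0 mulr0 -ltNge.
by split=> //; rewrite -ler_pdivlMr.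
Qed.

(** One cluster far from the global mean suffices for a non-trivial coarsening, so the maximiser is
    taken; positivity of the maximum rules out a zero denominator there. *)
Lemma gamma_max2_attained : (0 < K)%N -> (forall i j, 0 <= w i j) ->
  0 < gamma_max2 a lab w -> exists al, 0 < wbar lab w al /\
  gamma_max2 a lab w * wbar lab w al = enorm (centroid0 a - centroid a lab al).
Proof.
move=> K0 w0 gp.
have /mapP[al _ gE] : gamma_max2 a lab w \in
    [seq enorm (centroid0 a - centroid a lab al) / wbar lab w al | al <- enum 'I_K].
  by apply: max_of_mem; rewrite -size_eq0 size_map size_enum_ord -lt0n.
have W0 : wbar lab w al != 0.
  by apply: contraTneq gp => W0; rewrite gE W0 invr0 mulr0 ltxx.
exists al; split; first by rewrite lt_def W0 wbar_ge0.
by rewrite gE divfK.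
Qed.

End Gammas.

(** * Assembly of the two recovery statements *)

Theorem theorem10 (R : realType) (n d K : nat) (a : 'I_n -> 'cV[R]_d)
    (lab : 'I_n -> 'I_K) (w : 'I_n -> 'I_n -> R) (p c : R) :
  (* hidden partition: every V_alpha is nonempty *)
  (forall al : 'I_K, exists i : 'I_n, lab i = al) ->
  (* weights *)
  (forall i j, w i j = w j i) -> (forall i j, 0 <= w i j) ->
  (* (i) pairwise distinct centroids a^(0), a^(1), ..., a^(K) *)
  (forall al be : 'I_K, al != be -> centroid a lab al != centroid a lab be) ->
  (forall al : 'I_K, centroid0 a != centroid a lab al) ->
  (* (ii) weight condition *)
  (forall i j : 'I_n, lab i = lab j -> i != j ->
     0 < w i j /\ mu lab w (lab i) i j < nsz lab (lab i) * w i j) ->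
  (* (iii) *)
  (K * K.+1 < n)%N ->
  2 < p -> 0 < c ->
  let eps_min := Num.sqrt (c * p * ln (n%:R) / d%:R) in
  eps_min < 1 ->
  let gmin := gamma_min a lab w in
  let gmax := gamma_max a lab w in
  let gmax2 := gamma_max2 a lab w in
  let r := gmax / gmin in
  let r2 := gmax2 / gmin in
  let eps_sup := (r ^+ 2 - 1) / (r ^+ 2 + 1) in
  let eps_sup2 := (r2 ^+ 2 - 1) / (r2 ^+ 2 + 1) in
  let delta := 2 / (n%:R `^ p) in
  (* part 1 *)
  (Num.sqrt ((1 + eps_min) / (1 - eps_min)) < r ->
    eps_min < eps_sup /\
    forall (eps : R) (m : nat) (dT : measure_display) (T : measurableType dT)
      (P : probability T R) (Pi : T -> 'M[R]_(m, d)),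
      m%:R <= c * p * ln (n%:R) / eps ^+ 2 -> (m < d)%N ->
      DJL P Pi eps delta ->
      eps_min <= eps -> eps < eps_sup ->
      forall gh : R,
        Num.sqrt (1 + eps) * gmin <= gh -> gh < Num.sqrt (1 - eps) * gmax ->
        exists E : set T, measurable E /\
          E `<=` [set om | forall X : 'I_n -> 'cV[R]_m,
                    cc_optimal a w (Pi om) gh X -> perfectly_recovers lab X] /\
          ((1 - n%:R `^ (- (p - 2)))%:E < P E)%E)
  /\
  (* part 2 *)
  (Num.sqrt ((1 + eps_min) / (1 - eps_min)) < r2 ->
    eps_min < eps_sup2 /\
    forall (eps : R) (m : nat) (dT : measure_display) (T : measurableType dT)
      (P : probability T R) (Pi : T -> 'M[R]_(m, d)),
      m%:R <= c * p * ln (n%:R) / eps ^+ 2 -> (m < d)%N ->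
      DJL P Pi eps delta ->
      eps_min <= eps -> eps < eps_sup2 ->
      forall gh : R,
        Num.sqrt (1 + eps) * gmin <= gh -> gh < Num.sqrt (1 - eps) * gmax2 ->
        exists E : set T, measurable E /\
          E `<=` [set om | forall X : 'I_n -> 'cV[R]_m,
                    cc_optimal a w (Pi om) gh X ->
                    recovers_nontrivial_coarsening lab X] /\
          ((1 - n%:R `^ (- (p - 2)))%:E < P E)%E).
Proof.
move=> surj wC w0 cen cen0 gap Kn p2 c0 eps_min eps_min1 gmin gmax gmax2 r r2
  eps_sup eps_sup2 delta.
have gmin0 : 0 <= gmin by exact: gamma_min_ge0.
have n0 : (0 < n)%N by apply: leq_ltn_trans Kn.
have K0 : (0 < K)%N by apply: leq_ltn_trans (ltn_ord (lab (Ordinal n0))).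
have em0 : 0 <= eps_min by exact: sqrtr_ge0.
(* As [gmin >= 0], and division by 0 gives 0, a positive ratio forces a positive numerator. *)
have pos_num (q : R) : Num.sqrt ((1 + eps_min) / (1 - eps_min)) < q / gmin -> 0 < q.
  move=> h; have : 0 < q / gmin by apply: le_lt_trans h; exact: sqrtr_ge0.
  apply: contraTT; rewrite -!leNgt => q0.
  by rewrite mulr_le0_ge0 // invr_ge0.
split=> hr; (split; first exact: sqrt_ratio_lt);
  move=> eps m dT T P Pi _ _ djl eps_lb eps_ub gh gh_lb gh_ub.
- have gmax0 := pos_num _ hr.
  have e0 : 0 <= eps by exact: le_trans eps_lb.
  have e1 : eps <= 1 by apply/ltW/(lt_trans eps_ub)/sqr_ratio_lt1.
  have [E [mE PE hE]] := DJL_geometry P Pi eps delta a lab p djl e0 e1 erefl Kn.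
  exists E; split=> //; split=> // om /hE[hpts hcen _] X opt.
  have gh0 : 0 <= gh by apply: le_trans gh_lb; rewrite mulr_ge0 ?sqrtr_ge0.
  apply: perfect_recovery (opt) _ _ => //.
    exact: cc_optimal_gamma_min gh_lb opt.
  move=> al be ab; have [W0 hW] := gamma_max_lb a lab w al be w0 gmax0 ab.
  (* The strict bound on [gh] survives multiplication because the sum of the two [wbar] is
     positive. *)
  apply: lt_le_trans (hcen al be); apply: (@lt_le_trans _ _
    (Num.sqrt (1 - eps) * gmax * (wbar lab w al + wbar lab w be))).
    by rewrite ltr_pM2r.
  by rewrite -mulrA ler_wpM2l ?sqrtr_ge0.
- have gmax0 := pos_num _ hr.
  have e0 : 0 <= eps by exact: le_trans eps_lb.
  have e1 : eps <= 1 by apply/ltW/(lt_trans eps_ub)/sqr_ratio_lt1.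
  have [E [mE PE hE]] := DJL_geometry P Pi eps delta a lab p djl e0 e1 erefl Kn.
  exists E; split=> //; split=> // om /hE[hpts _ hcen] X opt.
  have gh0 : 0 <= gh by apply: le_trans gh_lb; rewrite mulr_ge0 ?sqrtr_ge0.
  have [al [W0 hW]] := gamma_max2_attained a lab w K0 w0 gmax0.
  apply: (@nontrivial_coarsening _ _ _ _ _ a lab w (Pi om) gh X al) => //.
    exact: cc_optimal_gamma_min gh_lb opt.
  (* At the maximising cluster [hW] is an equality, so the bound on [gh] transfers directly. *)
  by apply: lt_le_trans (hcen al); rewrite -hW (mulrA _ gmax2) ltr_pM2r.
Qed.
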